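(* Let $I$ be a linearly presented, $\mathfrak m$-primary monomial ideal in $S=K[x_1,\dots,x_n]$, generated in degree $d$. If the minimal resolution of $I$ is linear for $s$ steps ($s\ge1$), then $I^{t}=\mathfrak m^{td}$ for all integers $t\geq (n-1)/s$.
   Context: $K$ is a field, $S$ is graded with $\deg x_i=1$, and $\mathfrak m=(x_1,\dots,x_n)$. The resolution of an ideal $I$ generated in degree $d$ is linear for $q$ steps if for $0\le i\le q$ the $i$-th free module in the minimal graded free resolution of $I$ (starting with $i=0$ for the generators) is generated in degree $d+i$. Linearly presented means linear for $1$ step. *)

(* Defs.v *)
From HB Require Import structures.
From mathcomp Require Import all_boot all_order all_algebra.
From mathcomp Require Export mpoly.

Set Implicit Arguments.
Unset Strict Implicit.
Unset Printing Implicit Defensive.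

Import GRing.Theory.
Local Open Scope ring_scope.

(* Ideals are Prop-valued predicates: the ideals of ring_quotient are
   decidable and proper, which excludes the unit ideal I ^ 0. *)
Section Ideals.
Variable R : comNzRingType.
Implicit Types (G I J : R -> Prop).

Definition ideal_gen G : R -> Prop := fun f =>
  exists2 r : seq (R * R),
    (forall p, p \in r -> G p.2) & f = \sum_(p <- r) p.1 * p.2.

Definition ideal_eq I J : Prop := forall f, I f <-> J f.

Definition ideal_mul I J : R -> Prop :=
  ideal_gen (fun h => exists f g, [/\ I f, J g & h = f * g]).

Fixpoint ideal_exp I (t : nat) : R -> Prop :=
  if t is t'.+1 then ideal_mul I (ideal_exp I t') else fun=> True.

Definition radical I : R -> Prop := fun f => exists k : nat, I (f ^+ k).

Definition primary I : Prop :=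
  ~ I 1 /\ forall f g, I (f * g) -> I f \/ radical I g.

Definition primary_to I J : Prop := primary I /\ ideal_eq (radical I) J.

End Ideals.

Section Graded.
Variables (K : fieldType) (n : nat).
Local Notation S := {mpoly K[n]}.
Implicit Types (I : S -> Prop) (d q : nat).

Definition max_ideal : S -> Prop := ideal_gen (fun f => exists i : 'I_n, f = 'X_i).

Definition monomial_ideal I : Prop :=
  exists M : 'X_{1..n} -> Prop,
    ideal_eq I (ideal_gen (fun f => exists2 m, M m & f = 'X_[m])).

Definition generated_in_degree I d : Prop :=
  ideal_eq I (ideal_gen (fun f => I f /\ f \is d.-homog)).

(* The i-th module is F_i = \bigoplus_(j < rk i) S(- deg i j), its elements
   being row vectors; diff i : F_(i+1) -> F_i and aug : F_0 -> S act by right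
   multiplication. Finite length is rk i = 0 for large i.  Shifts in nat lose
   nothing: a minimal resolution of an ideal of S has no negative shifts. *)
Record free_complex := FreeComplex {
  rk : nat -> nat;
  deg : forall i, 'I_(rk i) -> nat;
  diff : forall i, 'M[S]_(rk i.+1, rk i);
  aug : 'cV[S]_(rk 0)
}.

(* diff is homogeneous of degree 0 for the shifted gradings: its (j, k) entry
   is zero or homogeneous of degree deg i.+1 j - deg i k >= 0. *)
Definition graded (F : free_complex) : Prop :=
  (forall j, aug F j 0 \is (deg (i := 0) j).-homog) /\
  (forall i j k m, m \in msupp (diff F i j k) ->
     (mdeg m + deg k)%N = deg j).

Definition resolves (F : free_complex) I : Prop :=
  [/\ forall f, I f <-> exists v : 'rV_(rk F 0), (v *m aug F) 0 0 = f,
      forall v : 'rV_(rk F 0),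
        v *m aug F = 0 <-> exists w, v = w *m diff F 0
    & forall i (v : 'rV_(rk F i.+1)),
        v *m diff F i = 0 <-> exists w, v = w *m diff F i.+1].

Definition minimal (F : free_complex) : Prop :=
  forall i j k, max_ideal (diff F i j k).

Definition minimal_graded_free_resolution (F : free_complex) I : Prop :=
  [/\ graded F, resolves F I & minimal F].

(* Minimal graded free resolutions exist and are unique up to isomorphism, so
   the quantifier over F only names "the" minimal resolution; F_i is generated
   in degree e exactly when all its shifts are e (vacuously if F_i = 0). *)
Definition linear_for_steps I d q : Prop :=
  exists2 F, minimal_graded_free_resolution F I &
    forall i (j : 'I_(rk F i)), (i <= q)%N -> deg j = (d + i)%N.

Definition linearly_presented I d : Prop := linear_for_steps I d 1.

End Graded.

Arguments max_ideal : clear implicits.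

(* Main.v *)
Require Import Defs.
From mathcomp Require Import all_boot all_order all_algebra.
From mathcomp Require Import zify.
From Stdlib Require Import Classical.

Set Implicit Arguments.
Unset Strict Implicit.
Unset Printing Implicit Defensive.
Import GRing.Theory Num.Theory.

(** Two facts carry the proof.

    Linearity puts monomials of small support into I
    ([small_support_mem]): if I is linear for s steps, then I contains every
    monomial of degree d whose support has at most s + 1 elements.  Let W be
    a set of p + 1 <= s + 1 variables and let u be a monomial in these
    variables that lies outside I.  As I contains a power of every variable,
    multiplying u by variables of W ends at a monomial u outside I with
    x_k u in I for all k in W.  In the Koszul complex of x_1, ..., x_n put
    z = u e_W.  Its boundary has coefficients in I, so it is a p-cycle of the
    Koszul complex with coefficients in I, homogeneous of degree
    deg u + p + 1.  It bounds no chain w with coefficients in I: otherwise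
    z - w would be a cycle, hence a boundary by exactness of the Koszul
    complex on S ([koszul_exact]), and its coefficient at e_W would lie in the
    ideal of the variables outside W; the monomial u would then occur in an
    element of I, which contradicts u not in I since I is a monomial ideal.
    On the other hand, a diagram chase between the Koszul complex and the free
    resolution F ([koszul_class_zero]) shows that every p-cycle with
    coefficients in I whose degree exceeds all the degrees of the generators
    of F_p is a boundary; this is the symmetry of Tor_p(I, K), made explicit.
    As F_p is generated in degree d + p, it follows that deg u < d, so every
    monomial of degree d in the variables of W lies in I.

    Monomials of degree t d split into blocks of small support
    ([split_block]): when n <= t s + 1, every monomial of degree t d in n
    variables is a product of t monomials of degree d, each with at most
    s + 1 variables.  One removes a factor at a time: the factor takes the
    full power of a set A of at most s variables and a part of the power of
    one further variable, and A is chosen as heavy as possible.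

    By the two facts I ^ t contains all monomials of degree t d, that is, it
    contains the power t d of the maximal ideal; the other inclusion holds by
    degree. *)

(** * Splitting a monomial into blocks of small support *)

Section Weights.
Variables (T : finType) (f : T -> nat).
Implicit Types (A V : {set T}).

Lemma sum_setD A V :
  A \subset V ->
  \sum_(i in V) f i = \sum_(i in A) f i + \sum_(i in V :\: A) f i.
Proof.
move=> AV; rewrite (bigID (mem A)) /=; congr (_ + _); apply: eq_bigl => i.
  by rewrite andb_idl // => /(subsetP AV).
by rewrite inE andbC.
Qed.

Lemma sum_swap A a b : a \in A -> b \notin A ->
  \sum_(i in b |: A :\ a) f i + f a = \sum_(i in A) f i + f b.
Proof.
move=> aA bA; rewrite big_setU1 ?inE ?negb_and ?bA ?orbT //=.
by rewrite [in RHS](big_setD1 a) //=; lia.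
Qed.

Lemma card_swap A a b : a \in A -> b \notin A -> #|b |: A :\ a| = #|A|.
Proof.
by move=> aA bA; rewrite cardsU1 !inE negb_and bA orbT (cardsD1 a A) aA.
Qed.

Lemma subset_swap A V a b :
  A \subset V -> b \in V -> b |: A :\ a \subset V.
Proof.
by move=> AV bV; rewrite subUset sub1set bV (subset_trans (subsetDl _ _) AV).
Qed.

(** A subset of minimal weight among those of cardinality q weighs at most its
    share of the total: by minimality no element of the subset is heavier than
    an element outside it, and one sums this over all such pairs. *)
Lemma light_subset V q : q <= #|V| ->
  exists A, [/\ A \subset V, #|A| = q &
                #|V| * \sum_(i in A) f i <= q * \sum_(i in V) f i].
Proof.
move=> /card_geqP[r [r_uniq r_size rV]].
pose P A := (A \subset V) && (#|A| == q).
have P0 : P [set i in r].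
  rewrite /P cardsE (card_uniqP r_uniq) r_size eqxx andbT.
  by apply/subsetP => i; rewrite inE => /rV.
case: (@arg_minnP _ _ P (fun A => \sum_(i in A) f i) P0).
move=> A /andP[AV /eqP Aq] Amin; exists A; split=> //.
have le_ab a b : a \in A -> b \in V :\: A -> f a <= f b.
  move=> aA; rewrite inE => /andP[bA bV].
  have := Amin (b |: A :\ a); rewrite /P subset_swap // card_swap // Aq eqxx.
  by move=> /(_ isT); have := sum_swap aA bA; lia.
have : \sum_(a in A) \sum_(b in V :\: A) f a
    <= \sum_(a in A) \sum_(b in V :\: A) f b.
  by apply: leq_sum => a aA; apply: leq_sum => b; apply: le_ab.
under eq_bigr do rewrite sum_nat_const.
rewrite -big_distrr sum_nat_const Aq cardsD (setIidPr AV) Aq (sum_setD AV) /=.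
have := subset_leq_card AV; rewrite Aq; nia.
Qed.

(** A is heaviest among the subsets of weight at most d and cardinality between
    #|V| - (t * s + 1) and s; [light_subset] provides one such subset.  If no
    single further element b brought the weight x of A up to d, then every b
    outside A would satisfy s * f b <= x: when A has s elements, because
    exchanging b for an element of A cannot make A heavier, and when A has
    fewer, because b could be added, so that f b = 0.  For the heaviest such b
    the total weight is at most x + (t * s + 1) * f b <= (t + 1) * x + f b,
    and x + f b < d makes this less than (t + 1) * d. *)
Lemma balanced_subset V d s t :
  #|V| <= t.+1 * s + 1 -> \sum_(i in V) f i = t.+1 * d ->
  exists A, [/\ A \subset V, #|A| <= s, #|V :\: A| <= t * s + 1,
      \sum_(i in A) f i <= d
    & \sum_(i in A) f i = d \/
      exists2 b, b \in V :\: A & d <= \sum_(i in A) f i + f b].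
Proof.
move=> Vcard Vsum; set q := #|V| - (t * s + 1).
have qV : q <= #|V| by rewrite leq_subr.
pose P A := [&& A \subset V, q <= #|A| <= s & \sum_(i in A) f i <= d].
have [A0 [A0V A0q A0sum]] := light_subset qV.
have P0 : P A0.
  rewrite /P A0V A0q leqnn /=; apply/andP; split; first by rewrite /q; lia.
  have [V0|V_gt0] := posnP #|V|; first by move: A0q; rewrite /q V0 => /eqP;
    rewrite cards_eq0 => /eqP->; rewrite big_set0.
  rewrite -(leq_pmul2l V_gt0); apply: leq_trans A0sum _; rewrite Vsum.
  by rewrite mulnA leq_mul2r; apply/orP; right; rewrite /q; nia.
case: (@arg_maxnP _ _ P (fun A => \sum_(i in A) f i) P0).
move=> A /and3P[AV /andP[Aq As] Ad] Amax; exists A; split=> //.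
  by rewrite cardsD (setIidPr AV); move: Aq; rewrite /q; lia.
have VE := sum_setD AV.
have [VA0|/set0Pn[b0 b0P]] := eqVneq (V :\: A) set0.
  by left; move: VE; rewrite VA0 big_set0 addn0 Vsum => VE; apply/eqP;
    rewrite eqn_leq Ad -VE mulSn leq_addr.
have [|noB] := boolP [exists (b | b \in V :\: A), d <= \sum_(i in A) f i + f b].
  by move=> /exists_inP[b bP bd]; right; exists b.
have ltB b : b \in V :\: A -> \sum_(i in A) f i + f b < d.
  move=> bP; rewrite ltnNge; apply: contra noB => bd.
  by apply/exists_inP; exists b.
have sB b : b \in V :\: A -> s * f b <= \sum_(i in A) f i.
  move=> /[dup] /ltB bd; rewrite inE => /andP[bA bV].
  have [sA|As'] := ltnP #|A| s.
    have := Amax (b |: A); rewrite /P subUset sub1set bV AV cardsU1 bA /=.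
    rewrite big_setU1 //= add1n (leqW Aq) sA addnC (ltnW bd) => /(_ isT).
    by nia.
  have sE : s = #|A| by apply/eqP; rewrite eqn_leq As' As.
  rewrite sE -sum_nat_const; apply: leq_sum => a aA.
  have := Amax (b |: A :\ a); rewrite /P subset_swap // card_swap // Aq As /=.
  have := sum_swap aA bA; have : f b <= f a \/ f a < f b by lia.
  case=> // ab swE; have -> : \sum_(i in b |: A :\ a) f i <= d by lia.
  by move=> /(_ isT); lia.
case: (@arg_maxnP _ b0 (mem (V :\: A)) f b0P) => b /= bP bmax.
have : \sum_(i in V :\: A) f i <= #|V :\: A| * f b.
  by rewrite -sum_nat_const; apply: leq_sum => i; apply: bmax.
have : #|V :\: A| <= t * s + 1.
  by rewrite cardsD (setIidPr AV); move: Aq; rewrite /q; lia.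
have := ltB b bP; have := sB b bP; move: VE; rewrite Vsum.
set x := \sum_(i in A) _; set y := \sum_(i in V :\: A) _; set w := #|_|.
move=> VE sx xd wle yle; exfalso.
have y_le : y <= (t * s + 1) * f b.
  by apply: leq_trans yle _; rewrite leq_mul2r wle orbT.
have : y <= t * x + f b.
  apply: leq_trans y_le _.
  by rewrite mulnDl mul1n leq_add2r -mulnA leq_mul2l sx orbT.
have : t * x <= t * d by rewrite leq_mul2l; lia.
by move: VE xd; rewrite mulSn; lia.
Qed.

End Weights.

(** The weights c are the exponents of the factor that is split off: full on A
    and, on the extra element b, whatever is missing from d. *)
Lemma split_block (T : finType) (f : T -> nat) d s t :
  #|[set i | 0 < f i]| <= t.+1 * s + 1 -> \sum_i f i = t.+1 * d ->
  exists c : T -> nat, [/\ forall i, c i <= f i, \sum_i c i = d,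
    #|[set i | 0 < c i]| <= s.+1 & #|[set i | c i < f i]| <= t * s + 1].
Proof.
set V := [set i | _] => Vcard fsum.
have sumE (A : {set T}) (g : T -> nat) : {in ~: A, forall i, g i = 0} ->
    \sum_i g i = \sum_(i in A) g i.
  move=> g0; rewrite [RHS]big_mkcond; apply: eq_bigr => i _.
  by case: ifPn => // iA; rewrite g0 // inE.
have Vsum : \sum_(i in V) f i = t.+1 * d.
  by rewrite -fsum (sumE V) // => i; rewrite !inE -eqn0Ngt => /eqP.
have [A [AV As VA Ad ex]] := balanced_subset Vcard Vsum.
have restV (c : T -> nat) : {in A, forall i, c i = f i} ->
    #|[set i | c i < f i]| <= t * s + 1.
  move=> cA; apply: leq_trans VA; apply/subset_leq_card/subsetP => i.
  rewrite !inE => ci; rewrite (leq_trans _ ci) // andbT.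
  by apply: contraTN ci => /cA->; rewrite ltnn.
case: ex => [dA|[b bP bd]].
  exists (fun i => if i \in A then f i else 0); split.
  - by move=> i; case: ifP.
  - rewrite -dA (sumE A); first by apply: eq_bigr => i ->.
    by move=> i; rewrite inE => /negPf->.
  - apply: leqW; apply: leq_trans As; apply/subset_leq_card/subsetP => i.
    by rewrite inE; case: ifP.
  - by apply: restV => i ->.
have /setDP[bV bA] := bP.
exists (fun i => if i \in A then f i
                 else if i == b then d - \sum_(i in A) f i else 0).
split.
- by move=> i; case: ifP => // _; case: eqP => // ->; rewrite leq_subLR.
- rewrite (sumE (b |: A)); last first.
    by move=> i; rewrite !inE negb_or => /andP[/negPf-> /negPf->].
  rewrite big_setU1 //= (negPf bA) eqxx.
  by rewrite -[RHS](subnK Ad); congr (_ + _); apply: eq_bigr => i ->.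
- apply: leq_trans (_ : #|b |: A| <= _); last by rewrite cardsU1 bA add1n ltnS.
  apply/subset_leq_card/subsetP => i; rewrite !inE.
  by case: ifP; rewrite ?orbT //; case: eqP.
- by apply: restV => i ->.
Qed.

Local Open Scope ring_scope.

(** * Coefficients of polynomials *)

Section Coefficients.
Variables (K : fieldType) (n : nat).
Local Notation S := {mpoly K[n]}.
Implicit Types (p q : S) (m u : 'X_{1..n}) (k l : 'I_n).

Definition mreindex (C : pred 'X_{1..n}) (g : 'X_{1..n} -> 'X_{1..n}) p : S :=
  \sum_(m <- msupp p | C m) p@_m *: 'X_[g m].

Lemma mcoeff_mreindex (C : pred _) g p m :
  {in C &, injective g} -> C m -> (mreindex C g p)@_(g m) = p@_m.
Proof.
move=> g_inj Cm; rewrite /mreindex raddf_sum /=.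
rewrite big_seq_cond (eq_bigr (fun m' => if m' == m then p@_m else 0)).
  rewrite -big_mkcondr /=; case: (boolP (m \in msupp p)) => [pm|pm].
    rewrite (big_rem m) //= pm Cm eqxx /= big1_seq ?addr0 // => m'.
    rewrite mem_rem_uniq ?msupp_uniq // !inE /=.
    by case/andP => /andP[_ /eqP->]; rewrite eqxx.
  rewrite (memN_msupp_eq0 pm) big1 // => m' /andP[/andP[pm' _] /eqP mm'].
move=> m' /andP[_ Cm']; rewrite mcoeffZ mcoeffX.
case: (eqVneq m' m) => [->|ne]; first by rewrite eqxx mulr1.
by rewrite (inj_in_eq g_inj) // (negPf ne) mulr0.
Qed.

Lemma mcoeff_mreindex0 (C : pred _) g p m :
  (forall m', C m' -> g m' != m) -> (mreindex C g p)@_m = 0.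
Proof.
move=> gm; rewrite /mreindex raddf_sum /= big1 // => m' Cm'.
by rewrite mcoeffZ mcoeffX (negPf (gm _ Cm')) mulr0.
Qed.

Definition mrestrict (C : pred 'X_{1..n}) := mreindex C id.

Lemma mcoeff_mrestrict (C : pred _) p m :
  (mrestrict C p)@_m = if C m then p@_m else 0.
Proof.
case: ifPn => Cm; first exact: (mcoeff_mreindex p (g := id)).
by apply: mcoeff_mreindex0 => m'; apply: contraTneq => ->.
Qed.

Lemma mcoeffXM k p m :
  ('X_k * p)@_m = if (0 < m k)%N then p@_(m - U_(k)) else 0.
Proof.
case: ifPn => mk.
  have {1}-> : m = (U_(k) + (m - U_(k)))%MM.
    by rewrite addmC submK // lep1mP -lt0n.
  by rewrite mulrC mcoeffMX.
apply: memN_msupp_eq0; apply: contra mk => /msuppM_le/allpairsP[[m1 m2] /=].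
by rewrite msuppX inE => -[/eqP-> _ ->]; rewrite mnmDE mnm1E eqxx.
Qed.

Definition zero_below k m := [forall l : 'I_n, (l < k)%N ==> (m l == 0%N)].

Lemma zero_belowP k m :
  reflect (forall l, (l < k)%N -> m l = 0%N) (zero_below k m).
Proof.
apply: (iffP forallP) => [mk l lk|mk l]; last by apply/implyP => /mk->.
by move: (mk l); rewrite lk => /eqP.
Qed.

(** Division by 'X_k on the monomials whose first variable is 'X_k, and 0 on
    all others. *)
Definition lead_quot k :=
  mreindex (fun m => zero_below k m && (0 < m k)%N) (fun m => m - U_(k))%MM.

Lemma mcoeff_lead_quot k p m :
  (lead_quot k p)@_m = if zero_below k m then p@_(m + U_(k)) else 0.
Proof.
have inj : {in fun m => zero_below k m && (0 < m k)%N &,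
              injective (fun m => m - U_(k))%MM}.
  move=> m1 m2 /andP[_ k1] /andP[_ k2] /(congr1 (fun m => m + U_(k))%MM).
  by rewrite !submK // lep1mP -lt0n.
have zbD m' : zero_below k (m' + U_(k))%MM = zero_below k m'.
  apply: eq_forallb => l; rewrite mnmDE mnm1E.
  case: (ltnP l k) => //=.
  by case: (eqVneq k l) => [->|_ _]; rewrite ?ltnn ?addn0.
case: ifPn => mk.
  rewrite -(mcoeff_mreindex p inj); first by rewrite addmK.
  by rewrite zbD mk mnmDE mnm1E eqxx addn1.
apply: mcoeff_mreindex0 => m' /andP[zb mk']; apply: contraNneq mk => <-.
by rewrite -zbD submK // lep1mP -lt0n.
Qed.

End Coefficients.

(** * The Koszul complex of the variables *)

Section Koszul.
Variables (K : fieldType) (n : nat).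
Local Notation S := {mpoly K[n]}.
Implicit Types (k l : 'I_n) (T : {set 'I_n}).

(** The sign of e_k in front of e_T in the exterior algebra. *)
Definition ksgn k T : S := (-1) ^+ #|[set l in T | (l < k)%N]|.

(** A Koszul chain with coefficients in V is stored as the function that gives
    its coefficient at each e_T; chains of all dimensions live together.  The
    coefficient of the boundary at e_T collects the contributions of the sets
    k |: T, which makes this the usual Koszul differential. *)
Definition kdiff (V : lmodType S) (c : {set 'I_n} -> V) T : V :=
  \sum_(k | k \notin T) (ksgn k T * 'X_k) *: c (k |: T).

Lemma ksgnU_ge k l T : (k <= l)%N -> ksgn k (l |: T) = ksgn k T.
Proof.
move=> kl; congr (_ ^+ #|pred_of_set _|); apply/setP => j; rewrite !inE.
by case: eqP => [->|//]; rewrite ltnNge kl /= andbF.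
Qed.

Lemma ksgnU_lt k l T : (l < k)%N -> l \notin T -> ksgn k (l |: T) = - ksgn k T.
Proof.
move=> lk lT; rewrite /ksgn.
have -> : [set j in l |: T | (j < k)%N] = l |: [set j in T | (j < k)%N].
  by apply/setP => j; rewrite !inE; case: eqP => [->|//]; rewrite lk.
by rewrite cardsU1 !inE (negPf lT) /= exprS mulN1r.
Qed.

Lemma kdiff_linear (V W : lmodType S) (f : {linear V -> W}) c T :
  kdiff (fun T' => f (c T')) T = f (kdiff c T).
Proof.
by rewrite /kdiff linear_sum; apply: eq_bigr => k _; rewrite linearZ.
Qed.

Lemma eq_kdiff (V : lmodType S) (c c' : {set 'I_n} -> V) :
  c =1 c' -> kdiff c =1 kdiff c'.
Proof. by move=> cc' T; apply: eq_bigr => k _; rewrite cc'. Qed.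

Lemma kdiffB (V : lmodType S) (c c' : {set 'I_n} -> V) T :
  kdiff (fun T' => c T' - c' T') T = kdiff c T - kdiff c' T.
Proof.
by rewrite /kdiff -sumrB; apply: eq_bigr => k _; rewrite scalerBr.
Qed.

(** The ordered pairs (k, l) outside T cancel against the pairs (l, k), since
    e_k and e_l anticommute. *)
Lemma kdiff_kdiff (V : lmodType S) (c : {set 'I_n} -> V) T :
  kdiff (kdiff c) T = 0.
Proof.
rewrite /kdiff.
pose F k l := (ksgn k T * 'X_k * (ksgn l (k |: T) * 'X_l)) *: c (l |: (k |: T)).
have FN k l : k \notin T -> l \notin T -> (k < l)%N -> F k l = - F l k.
  move=> kT lT kl; rewrite /F setUCA -scaleNr; congr (_ *: _).
  rewrite ksgnU_lt // (ksgnU_ge _ (ltnW kl)) !(mulrN, mulNr) mulrACA.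
  by congr (- _); rewrite [RHS]mulrACA; congr (_ * _); rewrite mulrC.
transitivity (\sum_(k | k \notin T) \sum_(l | (l \notin T) && (l != k)) F k l).
  apply: eq_bigr => k kT; rewrite scaler_sumr; apply: eq_big => l.
    by rewrite !inE negb_or andbC.
  by move=> _; rewrite scalerA.
transitivity (\sum_(k | k \notin T) \sum_(l | (l \notin T) && (k < l)%N) F k l
  + \sum_(k | k \notin T) \sum_(l | (l \notin T) && (l < k)%N) F k l).
  rewrite -big_split /=; apply: eq_bigr => k kT.
  rewrite (bigID (fun l : 'I_n => (k < l)%N)) /=; congr (_ + _);
    apply: eq_bigl => l; rewrite -andbA -(inj_eq val_inj) /=;
    congr (_ && _); lia.
rewrite [X in _ + X](exchange_big_dep (fun l => l \notin T)) /=; last first.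
  by move=> i j _ /andP[].
rewrite -big_split big1 //= => k kT.
rewrite [X in X + _](eq_bigr (fun l => - F l k)); last first.
  by move=> l /andP[lT kl]; rewrite FN.
rewrite sumrN addrC; apply/eqP; rewrite subr_eq0; apply/eqP.
by apply: eq_bigl => l; rewrite kT.
Qed.

(** The homotopy used for exactness.  The complex is graded by monomials, the
    term 'X_[m] e_T having degree m plus the indicator of T.  In a nonzero
    degree whose first variable is k, the homotopy moves the variable k from
    the monomial into e_T.  As k comes before all elements of T, no sign
    appears. *)
Definition kcontract r (c : {set 'I_n} -> 'rV[S]_r) T : 'rV[S]_r :=
  \row_j \sum_(k in T | [forall l in T, (k <= l)%N])
    lead_quot k (c (T :\ k) 0 j).

(** The variable k is the first one in the multidegree of 'X_[m] e_T. *)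
Definition kfirst k (m : 'X_{1..n}) T :=
  ((0 < m k)%N || (k \in T)) &&
  [forall l : 'I_n, (l < k)%N ==> (m l == 0%N) && (l \notin T)].

Lemma mcoeff_kcontract r (c : {set 'I_n} -> 'rV[S]_r) T j m k :
  kfirst k m T ->
  (kcontract c T 0 j)@_m =
    if k \in T then (c (T :\ k) 0 j)@_(m + U_(k)) else 0.
Proof.
case/andP => mTk /forallP lo; rewrite mxE raddf_sum /=.
have kT_le l : l \in T -> (k <= l)%N.
  move=> lT; rewrite leqNgt; apply/negP => lk.
  by move: (lo l); rewrite lk lT andbF.
have zb : zero_below k m.
  by apply/zero_belowP => l lk; move: (lo l); rewrite lk => /andP[/eqP].
case: ifPn => kT.
  rewrite (big_pred1 k) /=; first by rewrite mcoeff_lead_quot zb.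
  move=> l; apply/andP/eqP => [[lT /forall_inP/(_ k kT) lk]|->].
    by apply/val_inj/eqP; rewrite eqn_leq lk kT_le.
  by split=> //; apply/forall_inP.
rewrite big1 // => l /andP[lT _]; rewrite mcoeff_lead_quot; case: ifP => //.
have kl : (k < l)%N.
  by rewrite ltn_neqAle kT_le // andbT; apply: contraNneq kT => /val_inj->.
by move=> /zero_belowP/(_ k kl) mk; move: mTk; rewrite mk (negPf kT).
Qed.

Lemma mcoeff_kdiff r (c : {set 'I_n} -> 'rV[S]_r) T j m :
  (kdiff c T 0 j)@_m =
  \sum_(k | (k \notin T) && (0 < m k)%N)
    (-1) ^+ #|[set l in T | (l < k)%N]| * (c (k |: T) 0 j)@_(m - U_(k)).
Proof.
rewrite summxE raddf_sum big_mkcondr /=; apply: eq_bigr => k kT.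
rewrite mxE -mulrA /ksgn -[-1]mpolyCN -rmorphXn /= mcoeffCM mcoeffXM.
by case: ifP => // _; rewrite mulr0.
Qed.

(** The condition on the coefficient of e_set0 removes the homology of the
    complex, which is K in dimension 0.  Coefficient by coefficient, fix
    'X_[m] e_T and let k be the first variable of its multidegree.  If k is
    not in T, only the index k contributes to the boundary of the contraction.
    If k is in T, the sum is rewritten with the equation dc = 0 at T :\ k. *)
Lemma koszul_exact r (c : {set 'I_n} -> 'rV[S]_r) :
  (forall T, kdiff c T = 0) -> (forall j, (c set0 0 j)@_0 = 0) ->
  kdiff (kcontract c) =1 c.
Proof.
move=> dc0 c0 T; apply/rowP => j; apply/mpolyP => m; rewrite mcoeff_kdiff.
case: (pickP (fun k => (0 < m k)%N || (k \in T))) => [k0 k0P|noP]; last first.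
  have T0 : T = set0.
    by apply/setP => k; rewrite inE; move: (noP k) => /norP[_ /negPf].
  have m0 : m = 0%MM.
    apply/mnmP => k; rewrite mnm0E; apply/eqP; rewrite -leqn0 leqNgt.
    by move: (noP k) => /norP[].
  rewrite T0 m0 c0 big1 // => k /andP[_]; rewrite mnm0E ltnn //.
case: (@arg_minnP _ k0 (fun k => (0 < m k)%N || (k \in T)) val k0P).
move=> k kP kmin.
have lo l : (l < k)%N -> m l = 0%N /\ l \notin T.
  move=> lk; have /norP[ml lT] : ~~ ((0 < m l)%N || (l \in T)).
    by apply/negP => /kmin; rewrite leqNgt lk.
  by split=> //; apply/eqP; rewrite -leqn0 leqNgt.
have kf l : l \notin T -> (0 < m l)%N -> kfirst k (m - U_(l))%MM (l |: T).
  move=> lT ml; apply/andP; split.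
    rewrite !inE mnmBE mnm1E.
    case: (eqVneq k l) => /= kl; first by rewrite orbT.
    by rewrite subn0.
  apply/forallP => i; apply/implyP => /[dup] ik /lo[mi iT].
  rewrite mnmBE mi sub0n /= !inE negb_or iT andbT.
  by apply: contraTneq ml => <-; rewrite mi.
have E l : (l \notin T) && (0 < m l)%N ->
    (kcontract c (l |: T) 0 j)@_(m - U_(l)) =
    if k \in l |: T then (c ((l |: T) :\ k) 0 j)@_(m - U_(l) + U_(k)) else 0.
  by case/andP => lT ml; apply: mcoeff_kcontract; apply: kf.
under eq_bigr => l lP do rewrite (E _ lP).
have sgk T' : T' \subset T -> #|[set l in T' | (l < k)%N]| = 0%N.
  move=> sT; apply/eqP; rewrite cards_eq0; apply/eqP/setP => l; rewrite !inE.
  by apply/negP => /andP[/(subsetP sT) lT /lo[_]]; rewrite lT.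
case: (boolP (k \in T)) => kT.
  (* In the equation dc = 0 at T :\ k the index k contributes the wanted
     coefficient; every other index occurs in the sum with opposite sign. *)
  have := congr1 (fun v : 'rV_r => (v 0 j)@_(m + U_(k))) (dc0 (T :\ k)).
  rewrite mcoeff_kdiff mxE mcoeff0 (bigD1 k) /=; last first.
    by rewrite !inE eqxx mnmDE mnm1E eqxx addn1.
  rewrite sgk ?subsetDl // mul1r setD1K // addmK.
  move/eqP; rewrite addr_eq0 => /eqP->; rewrite -sumrN.
  apply: eq_big => [l|l /andP[lT ml]].
    rewrite !inE mnmDE mnm1E negb_and negbK andbC.
    case: (eqVneq l k) => [->|lk] /=; first by rewrite kT !andbF.
    by rewrite addn0 !andbT andbC.
  have lk : l != k by apply: contraNneq lT => ->.
  rewrite inE kT orbT -mulNr.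
  have -> : (l |: T) :\ k = l |: (T :\ k).
    apply/setP => i; rewrite !inE.
    by case: (eqVneq i l) => [->|] //=; rewrite lk.
  congr (_ * _).
    have kl : (k < l)%N.
      rewrite ltnNge leq_eqVlt (inj_eq val_inj) (negPf lk) /=.
      by apply/negP => /lo[ml0]; rewrite ml0 in ml.
    have {1}-> : [set i in T | (i < l)%N] = k |: [set i in T :\ k | (i < l)%N].
      apply/setP => i; rewrite !inE.
      by case: (eqVneq i k) => [->|] //=; rewrite kT.
    by rewrite cardsU1 !inE eqxx /= exprS mulN1r.
  congr (_@__); apply/mnmP => i; rewrite !(mnmBE, mnmDE, mnm1E).
  by case: (eqVneq l i) => [<-|_] /=; lia.
have mk : (0 < m k)%N by move: kP; rewrite (negPf kT) orbF.
rewrite (bigD1 k) /= ?kT // sgk // mul1r !inE eqxx /= submK ?lep1mP -?lt0n //.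
rewrite setU1K // big1 ?addr0 // => l /andP[_ lk].
by rewrite !inE eq_sym (negPf lk) (negPf kT) mulr0.
Qed.

End Koszul.

(** * Degrees and lifting along graded matrices *)

Section Lifting.
Variables (K : fieldType) (n : nat).
Local Notation S := {mpoly K[n]}.
Implicit Types (p q : S) (m : 'X_{1..n}).

(** Membership in the e-th power of the maximal ideal, read off the
    monomials. *)
Definition order_ge e p := forall m, m \in msupp p -> (e <= mdeg m)%N.

Lemma msupp_sum_ex (T : eqType) (r : seq T) (F : T -> S) m :
  m \in msupp (\sum_(i <- r) F i) -> exists2 i, i \in r & m \in msupp (F i).
Proof.
move/msupp_sum_le/flatten_mapP => [i]; rewrite mem_filter => /= ir mi.
by exists i.
Qed.

Lemma msuppM_ex p q m : m \in msupp (p * q) ->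
  exists m1 m2, [/\ m1 \in msupp p, m2 \in msupp q & m = (m1 + m2)%MM].
Proof. by move/msuppM_le/allpairsP => [[m1 m2] /= [? ? ->]]; exists m1, m2. Qed.

Lemma order_ge_gen (G : S -> Prop) e :
  (forall g, G g -> order_ge e g) -> forall p, ideal_gen G p -> order_ge e p.
Proof.
move=> Ge p [r rG ->] m /msupp_sum_ex[x /rG/Ge xe].
by move=> /msuppM_ex[m1 [m2 [_ /xe em2 ->]]]; rewrite mdegD; lia.
Qed.

Lemma order_ge_max p : max_ideal K n p -> order_ge 1 p.
Proof.
apply: order_ge_gen => _ [i ->] m; rewrite msuppX inE => /eqP->.
by rewrite mdeg1.
Qed.

(** The shifted degrees of the monomials of v, where the j-th basis vector has
    degree dg j, all satisfy Q.  Homogeneity is the case Q = pred1 N; the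
    predicate predC1 N describes what is left after removal of the homogeneous
    part of degree N. *)
Definition degrees_in r (dg : 'I_r -> nat) (Q : pred nat) (v : 'rV[S]_r) :=
  forall j m, m \in msupp (v 0 j) -> Q (mdeg m + dg j)%N.

Definition graded_mx r r' (dg : 'I_r -> nat) (dg' : 'I_r' -> nat)
  (D : 'M[S]_(r, r')) :=
  forall j k m, m \in msupp (D j k) -> (mdeg m + dg' k)%N = dg j.

Lemma degrees_in_mulmx r r' dg dg' (D : 'M_(r, r')) Q v :
  graded_mx dg dg' D -> degrees_in dg Q v -> degrees_in dg' Q (v *m D).
Proof.
move=> gD vQ k m; rewrite mxE => /msupp_sum_ex[j _].
move=> /msuppM_ex[m1 [m2 [/vQ + /gD jD ->]]].
by rewrite mdegD -jD addnA.
Qed.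

(** The homogeneous part of degree N of v is a preimage as well: D preserves
    degrees, so the remaining part of v maps to an element that has no
    monomial of degree N but is a difference of elements of degree N. *)
Lemma graded_lift r r' dg dg' (D : 'M_(r, r')) N v :
  graded_mx dg dg' D -> degrees_in dg' (pred1 N) (v *m D) ->
  exists2 v', degrees_in dg (pred1 N) v' & v' *m D = v *m D.
Proof.
move=> gD vD.
pose vN (Q : pred nat) : 'rV[S]_r :=
  \row_j mrestrict (fun m => Q (mdeg m + dg j)%N) (v 0 j).
have vNQ Q : degrees_in dg Q (vN Q).
  move=> j m; rewrite mxE mcoeff_msupp mcoeff_mrestrict.
  by case: ifP => //; rewrite eqxx.
exists (vN (pred1 N)) => //; apply/eqP; rewrite -subr_eq0; apply/eqP/rowP => k.
have vE : v = vN (pred1 N) + vN (predC1 N).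
  apply/rowP => j; apply/mpolyP => m.
  rewrite 3!mxE mcoeffD !mcoeff_mrestrict /=.
  by case: eqP => _ /=; rewrite ?addr0 ?add0r.
have eqN : vN (pred1 N) *m D - v *m D = - (vN (predC1 N) *m D).
  by rewrite {1}vE mulmxDl opprD addNKr.
have D1 := degrees_in_mulmx gD (vNQ (pred1 N)).
have D2 := degrees_in_mulmx gD (vNQ (predC1 N)).
apply/mpolyP => m; rewrite [X in _ = X@__]mxE mcoeff0.
apply/eqP; rewrite mcoeff_eq0; apply/negP => mk.
move: (mk); rewrite eqN mxE (perm_mem (msuppN _)) => /D2 /= /negP; apply.
move: mk; rewrite mxE => /msuppD_le; rewrite mem_cat => /orP[/D1//|].
by rewrite mxE (perm_mem (msuppN _)) => /vD.
Qed.

(** Here e_T counts for #|T| in the degree, so that the Koszul differential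
    preserves degrees. *)
Definition chain_degree r (dg : 'I_r -> nat) N (c : {set 'I_n} -> 'rV[S]_r) :=
  forall T : {set 'I_n}, degrees_in dg (fun e => e + #|T| == N)%N (c T).

Lemma chain_degree_kdiff r dg N (c : {set 'I_n} -> 'rV[S]_r) :
  chain_degree dg N c -> chain_degree dg N (kdiff c).
Proof.
move=> cN T j m; rewrite mcoeff_msupp mcoeff_kdiff => nz.
have [k /andP[kT mk] ck] : exists2 k, (k \notin T) && (0 < m k)%N &
    (c (k |: T) 0 j)@_(m - U_(k)) != 0.
  apply/exists_inP; apply: contraNT nz; rewrite negb_exists_in.
  move/forall_inP => z; rewrite big1 // => k kP.
  by move: (z k kP); rewrite negbK => /eqP->; rewrite mulr0.
rewrite -mcoeff_msupp in ck; have := cN _ _ _ ck; rewrite cardsU1 kT.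
have {2}-> : m = (m - U_(k) + U_(k))%MM by rewrite submK // lep1mP -lt0n.
by rewrite mdegD mdeg1; lia.
Qed.

Definition chain_dim r (p : nat) (c : {set 'I_n} -> 'rV[S]_r) :=
  forall T : {set 'I_n}, #|T| != p -> c T = 0.

Lemma chain_dim_kdiff r (p : nat) (c : {set 'I_n} -> 'rV[S]_r) :
  chain_dim p.+1 c -> chain_dim p (kdiff c).
Proof.
move=> cp T Tp; rewrite /kdiff big1 // => k kT.
by rewrite cp ?scaler0 // cardsU1 kT.
Qed.

Lemma mcoeff0_chain_dim r (p : nat) (c : {set 'I_n} -> 'rV[S]_r) j :
  chain_dim p.+1 c -> (c set0 0 j)@_0 = 0.
Proof. by move=> ->; rewrite ?cards0 // mxE mcoeff0. Qed.

Lemma kdiff_dim0 r (c : {set 'I_n} -> 'rV[S]_r) T :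
  chain_dim 0 c -> kdiff c T = 0.
Proof.
move=> cp; rewrite /kdiff big1 // => k kT.
by rewrite cp ?scaler0 // cardsU1 kT.
Qed.

(** The lift is chosen separately for each set T, with value 0 outside
    dimension p; if #|T| > N, homogeneity already forces c T = 0. *)
Lemma chain_lift r r' dg dg' (D : 'M_(r, r')) N (p : nat)
    (c : {set 'I_n} -> 'rV[S]_r') :
  graded_mx dg dg' D -> chain_degree dg' N c -> chain_dim p c ->
  (forall T, exists w, c T = w *m D) ->
  exists b, [/\ chain_degree dg N b, chain_dim p b & forall T, b T *m D = c T].
Proof.
move=> gD cN cp cD.
have lift (T : {set 'I_n}) : exists w,
    [/\ degrees_in dg (fun e => e + #|T| == N)%N w,
        (#|T| != p -> w = 0) & w *m D = c T].
  case: (eqVneq #|T| p) => [Tp|/cp->]; last first.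
    by exists 0; split=> //; rewrite ?mul0mx // => j m; rewrite mxE msupp0.
  have [w cw] := cD T; have := cN T; rewrite cw.
  case: (leqP #|T| N) => [TN|NT] wN.
    have [|w' w'N w'D] := @graded_lift _ _ dg dg' D (N - #|T|)%N w gD.
      by move=> j m /wN /eqP wE; apply/eqP; move: wE TN; rewrite /=; lia.
    exists w'; split=> // j m /w'N /eqP wE; apply/eqP.
    by move: wE TN; rewrite /=; lia.
  have w0 : w *m D = 0.
    apply/rowP => j; rewrite [RHS]mxE; apply: msuppnil0.
    by case E: (msupp _) => [//|m s]; have /wN : m \in msupp ((w *m D) 0 j);
      rewrite ?E ?mem_head //; lia.
  by exists 0; split; rewrite ?mul0mx ?w0 // => j m; rewrite mxE msupp0.
have [b bP] := fin_all_exists lift.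
by exists b; split=> [T|T|T]; case: (bP T).
Qed.

End Lifting.

(** * Koszul cycles and free resolutions *)

Section TorVanishing.
Variables (K : fieldType) (n : nat) (I : {mpoly K[n]} -> Prop).
Variables (F : free_complex K n).
Hypothesis F_res : minimal_graded_free_resolution F I.
Local Notation S := {mpoly K[n]}.

Lemma mcoeff0_minimal i (v : 'rV[S]_(rk F i.+1)) j :
  ((v *m diff F i) 0 j)@_0 = 0.
Proof.
have [_ _ Fmin] := F_res.
apply: memN_msupp_eq0; rewrite mxE; apply/negP => /msupp_sum_ex[k _].
move=> /msuppM_ex[m1 [m2 [_ /(order_ge_max (Fmin _ _ _)) m2_gt0 /esym/eqP]]].
by rewrite mnmD_eq0 => /andP[_ /eqP m20]; rewrite m20 mdeg0 in m2_gt0.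
Qed.

(** The balancing of Tor, one element at a time.  A p-chain c with coefficients
    in F_i whose Koszul boundary comes from F_(i+1) gives a (p-1)-chain with
    coefficients in F_(i+1) of the same kind, and so on down to a 0-chain with
    coefficients in F_q.  The entries of that 0-chain have positive degree
    because N exceeds the degrees of the generators of F_q; hence it is a
    Koszul boundary.  Going back up, exactness of the Koszul complex turns
    this into the decomposition of c. *)
Lemma koszul_class_zero q p i N (c : {set 'I_n} -> 'rV[S]_(rk F i)) :
  (i + p)%N = q -> (forall j : 'I_(rk F q), deg j < N)%N ->
  chain_degree (@deg _ _ F i) N c -> chain_dim p c ->
  (forall T, exists w, kdiff c T = w *m diff F i) ->
  exists b b', forall T, c T = kdiff b T + b' T *m diff F i.
Proof.
have [[_ gF] [_ ex0 exS] _] := F_res.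
move=> + degF; elim: p i c => [|p IHp] i c ip cN cp cD.
  rewrite addn0 in ip; subst i.
  exists (kcontract c), (fun=> 0) => T; rewrite mul0mx addr0 koszul_exact //.
    by move=> {}T; apply: kdiff_dim0.
  move=> j; apply: memN_msupp_eq0; apply/negP => /cN.
  rewrite cards0 mdeg0 addn0 add0n => /eqP jN.
  by move: (degF j); rewrite jN ltnn.
have [c' [c'N c'p c'D]] :=
  chain_lift (gF i) (chain_degree_kdiff cN) (chain_dim_kdiff cp) cD.
have ip' : (i.+1 + p = q)%N by rewrite addSnnS.
have [|b' [b'' c'E]] := IHp i.+1 c' ip' c'N c'p.
  move=> T; apply/exS.
  rewrite -[LHS](kdiff_linear (mulmxr (diff F i))) /=.
  by rewrite (eq_kdiff c'D) kdiff_kdiff.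
have exD T : b'' T *m diff F i.+1 *m diff F i = 0 by apply/exS; exists (b'' T).
pose a T := c T - b' T *m diff F i.
have aE T : kdiff a T = 0.
  rewrite /a kdiffB (kdiff_linear (mulmxr (diff F i))) /= -c'D c'E.
  by rewrite mulmxDl exD addr0 subrr.
exists (kcontract a), b' => T.
rewrite koszul_exact ?subrK // => j.
rewrite mxE mcoeffD mxE mcoeffN mcoeff0_minimal.
by rewrite (mcoeff0_chain_dim _ cp) subr0.
Qed.

End TorVanishing.

(** * Ideals and their monomials *)

Section Ideals.
Variable R : comNzRingType.
Implicit Types (G J : R -> Prop) (f g : R).

(** The axioms of an ideal as a plain predicate, which also admits the unit
    ideal. *)
Definition is_ideal J :=
  [/\ J 0, forall f g, J f -> J g -> J (f + g) & forall f g, J g -> J (f * g)].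

Lemma ideal_gen_is_ideal G : is_ideal (ideal_gen G).
Proof.
split=> [|_ _ [r1 G1 ->] [r2 G2 ->]|f _ [r Gr ->]].
- by exists [::]; rewrite ?big_nil.
- exists (r1 ++ r2); last by rewrite big_cat.
  by move=> x; rewrite mem_cat => /orP[/G1|/G2].
exists [seq (f * x.1, x.2) | x <- r].
  by move=> _ /mapP[x /Gr Gx ->].
by rewrite big_map mulr_sumr; apply: eq_bigr => x _; rewrite mulrA.
Qed.

Lemma mem_ideal_gen G g : G g -> ideal_gen G g.
Proof.
move=> Gg; exists [:: (1, g)]; last by rewrite big_seq1 mul1r.
by move=> x; rewrite inE => /eqP->.
Qed.

Lemma ideal_eq_gen_is_ideal J G : ideal_eq J (ideal_gen G) -> is_ideal J.
Proof.
move=> JG; have [G0 GD GM] := ideal_gen_is_ideal G.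
split=> [|f g /JG Jf /JG Jg|f g /JG Jg]; apply/JG => //; first exact: GD.
exact: GM.
Qed.

Lemma ideal_exp_is_ideal J t : is_ideal (ideal_exp J t).
Proof. by case: t => [|t] //=; apply: ideal_gen_is_ideal. Qed.

Lemma ideal_expSM J t f g :
  J f -> ideal_exp J t g -> ideal_exp J t.+1 (f * g).
Proof. by move=> Jf Jg; apply: mem_ideal_gen; exists f, g. Qed.

Lemma is_ideal_sum J (T : eqType) (r : seq T) (F : T -> R) :
  is_ideal J -> (forall i, i \in r -> J (F i)) -> J (\sum_(i <- r) F i).
Proof.
move=> [J0 JD _] JF; elim: r JF => [|i r IHr] JF; first by rewrite big_nil.
rewrite big_cons; apply: JD; first by apply: JF; rewrite mem_head.
by apply: IHr => j jr; apply: JF; rewrite in_cons jr orbT.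
Qed.

End Ideals.

Section Monomials.
Variables (K : fieldType) (n : nat).
Local Notation S := {mpoly K[n]}.
Implicit Types (J : S -> Prop) (f : S) (m u a : 'X_{1..n}).

Lemma is_ideal_msupp J f :
  is_ideal J -> (forall m, m \in msupp f -> J 'X_[m]) -> J f.
Proof.
move=> Jid Jm; rewrite (mpolyE f); apply: is_ideal_sum => // m /Jm Xm.
by have [_ _ JM] := Jid; rewrite -mul_mpolyC; apply: JM.
Qed.

Lemma is_ideal_Xle J a m :
  is_ideal J -> (a <= m)%MM -> J 'X_[a] -> J 'X_[m].
Proof. by move=> [_ _ JM] am Ja; rewrite -(submK am) mpolyXD; apply: JM. Qed.

Lemma monomial_ideal_msupp J f m :
  monomial_ideal J -> J f -> m \in msupp f -> J 'X_[m].
Proof.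
move=> [M JM] /JM[r rM ->] /msupp_sum_ex[x /rM[a Ma ->]].
move=> /msuppM_ex[m1 [m2 [_ + ->]]]; rewrite msuppX inE => /eqP->.
apply: (is_ideal_Xle (ideal_eq_gen_is_ideal JM) (lem_addl _ _)).
by apply/JM/mem_ideal_gen; exists a.
Qed.

Lemma order_ge_exp J e t f :
  (forall g, J g -> order_ge e g) -> ideal_exp J t f -> order_ge (t * e) f.
Proof.
move=> Je; elim: t f => [|t IHt] f /=; first by move=> _ m _; rewrite mul0n.
apply: order_ge_gen => _ [g [h [/Je ge /IHt he ->]]] m.
by move=> /msuppM_ex[m1 [m2 [/ge e1 /he e2 ->]]]; rewrite mdegD mulSn leq_add.
Qed.

Lemma mem_max_exp k m : (k <= mdeg m)%N -> ideal_exp (max_ideal K n) k 'X_[m].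
Proof.
elim: k m => [|k IHk] m km //.
have [i mi] : exists i, (0 < m i)%N.
  apply/existsP; apply: contraLR km; rewrite negb_exists -leqNgt => /forallP m0.
  by rewrite mdegE big1 // => i _; apply/eqP; rewrite -leqn0 leqNgt.
have mE : m = (U_(i) + (m - U_(i)))%MM by rewrite addmC submK // lep1mP -lt0n.
rewrite mE mpolyXD; apply: ideal_expSM; first by apply: mem_ideal_gen; exists i.
by apply: IHk; move: km; rewrite {1}mE mdegD mdeg1 add1n ltnS.
Qed.

Lemma submonomial_split d m : (d <= mdeg m)%N ->
  exists2 a, mdeg a = d & (a <= m)%MM.
Proof.
elim: d => [|d IHd] dm.
  by exists 0%MM; rewrite ?mdeg0 //; apply/mnm_lepP => i; rewrite mnm0E.
have [a ad am] := IHd (ltnW dm).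
have [i ai] : exists i, (a i < m i)%N.
  apply/existsP; apply: contraLR dm; rewrite negb_exists -leqNgt => /forallP m0.
  by rewrite -ad !mdegE; apply: leq_sum => i _; rewrite leqNgt.
exists (a + U_(i))%MM; first by rewrite mdegD mdeg1 ad addn1.
apply/mnm_lepP => j; rewrite mnmDE mnm1E.
case: eqP => [<-|_]; first by rewrite addn1.
by rewrite addn0; apply: (mnm_lepP am).
Qed.

End Monomials.

(** * Monomials of small support in a linear ideal *)

Section Socle.
Variables (K : fieldType) (n : nat) (I : {mpoly K[n]} -> Prop).
Local Notation S := {mpoly K[n]}.
Hypothesis I_mon : monomial_ideal I.
Hypothesis I_max : forall f, I f -> max_ideal K n f.

Lemma monomial_ideal_is_ideal : is_ideal I.
Proof. by have [M /ideal_eq_gen_is_ideal] := I_mon. Qed.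

(** The monomial u represents a socle element of the quotient by I in the
    variables of W.  The boundary of the Koszul chain z = u e_W is a p-cycle
    with coefficients in I.  If d <= mdeg u, its degree exceeds that of the
    generators of F_p, so it bounds a chain with coefficients in I; comparing
    with z at e_W, where only variables outside W can contribute to a
    boundary, shows that u occurs in an element of I. *)
Lemma socle_degree (F : free_complex K n) d p (W : {set 'I_n}) (u : 'X_{1..n}) :
  minimal_graded_free_resolution F I ->
  (forall j : 'I_(rk F p), deg j = d + p)%N ->
  #|W| = p.+1 -> (forall k, (0 < u k)%N -> k \in W) ->
  ~ I 'X_[u] -> (forall k, k \in W -> I 'X_[u + U_(k)]) -> (mdeg u < d)%N.
Proof.
move=> Fres degF Wp uW uI uWI; rewrite ltnNge; apply/negP => du.
have [[gaug _] [augI ex0 _] _] := Fres.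
have Iid := monomial_ideal_is_ideal; have [I0 _ IM] := Iid.
pose z (T : {set 'I_n}) : 'rV[S]_1 := if T == W then const_mx 'X_[u] else 0.
pose N := (mdeg u + p.+1)%N.
have zN : chain_degree (fun=> 0%N) N z.
  move=> T j m; rewrite /z; case: eqP => [->|_]; rewrite mxE ?msupp0 //.
  by rewrite msuppX inE addn0 Wp => /eqP->.
have zp : chain_dim p.+1 z.
  by move=> T; rewrite /z; case: (T =P W) => [->|//]; rewrite Wp eqxx.
have dzI T : exists w, kdiff z T = w *m aug F.
  have [|w wE] := (augI (kdiff z T 0 0)).1; last first.
    by exists w; apply/rowP => j; rewrite ord1 wE.
  rewrite summxE; elim/big_ind: _ => // [|k kT]; first by have [] := Iid.
  rewrite mxE /z; case: eqP => [kTW|_]; rewrite mxE ?mulr0 //.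
  rewrite -mulrA -mpolyXD addmC; apply: IM; apply: uWI.
  by rewrite -kTW setU11.
have gA : graded_mx (@deg _ _ F 0) (fun=> 0%N) (aug F).
  by move=> j k m; rewrite ord1 addn0; apply: dhomog_mf.
have [c [cN cp cE]] :=
  chain_lift gA (chain_degree_kdiff zN) (chain_dim_kdiff zp) dzI.
have dcF T : exists w, kdiff c T = w *m diff F 0.
  apply/ex0; rewrite -[LHS](kdiff_linear (mulmxr (aug F))) /=.
  by rewrite (eq_kdiff cE) kdiff_kdiff.
have degN (j : 'I_(rk F p)) : (deg j < N)%N by rewrite degF /N; lia.
have [b [b' bE]] := koszul_class_zero Fres (add0n p) degN cN cp dcF.
have exD T : b' T *m diff F 0 *m aug F = 0 by apply/ex0; exists (b' T).
(* Augmenting b gives a chain with coefficients in I and the same boundary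
   as z. *)
pose y T := z T - b T *m aug F.
have yI T : I ((b T *m aug F) 0 0) by apply/augI; exists (b T).
have y_ex : kdiff (kcontract y) =1 y.
  apply: koszul_exact => [T|j].
    rewrite /y kdiffB (kdiff_linear (mulmxr (aug F))) /= -cE bE.
    by rewrite mulmxDl exD addr0 subrr.
  rewrite ord1 mxE mcoeffD mxE mcoeffN [X in _ - X]memN_msupp_eq0 ?subr0.
    by rewrite (mcoeff0_chain_dim _ zp).
  by apply/negP => /(order_ge_max (I_max (yI _))); rewrite mdeg0.
have := congr1 (fun v : 'rV_1 => (v 0 0)@_u) (y_ex W).
rewrite mcoeff_kdiff big1 => [|k /andP[kW /uW]]; last by rewrite (negPf kW).
rewrite mxE mcoeffD mxE mcoeffN /z eqxx mxE mcoeffX eqxx => /esym/eqP.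
rewrite subr_eq0 => /eqP fu; apply/uI/(monomial_ideal_msupp I_mon (yI W)).
by rewrite mcoeff_msupp -fu oner_eq0.
Qed.

Hypothesis I_pow : forall k : 'I_n, exists e, I ('X_k ^+ e).

(** If no exponent of u reaches the power of its variable that lies in I, the
    degree of u is at most the sum of these powers. *)
Lemma standard_bounded :
  exists B, forall u : 'X_{1..n}, (B < mdeg u)%N -> I 'X_[u].
Proof.
have [e eI] := fin_all_exists I_pow; exists (\sum_k e k)%N => u Bu.
have [k ku] : exists k, (e k <= u k)%N.
  apply/existsP; apply: contraLR Bu; rewrite negb_exists -leqNgt mdegE.
  move=> /forallP eu.
  by apply: leq_sum => k _; rewrite ltnW // ltnNge.
apply: (is_ideal_Xle monomial_ideal_is_ideal (a := (U_(k) *+ e k)%MM)).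
  apply/mnm_lepP => j; rewrite mulmnE mnm1E; case: eqP => [<-|_] //.
  by rewrite mul1n.
by rewrite -mpolyXn.
Qed.

(** Multiplying u by the variables of W only increases the degree, so by
    induction downwards from the bound of [standard_bounded] all these
    products lie in I, and [socle_degree] applies to u. *)
Lemma small_support_mem (F : free_complex K n) d p (W : {set 'I_n})
    (u : 'X_{1..n}) :
  minimal_graded_free_resolution F I ->
  (forall j : 'I_(rk F p), deg j = d + p)%N ->
  #|W| = p.+1 -> (forall k, (0 < u k)%N -> k \in W) ->
  (d <= mdeg u)%N -> I 'X_[u].
Proof.
move=> Fres degF Wp; have [B BI] := standard_bounded.
have [r] := ubnP (B.+1 - mdeg u); elim: r u => // r IHr u ru uW du.
have [/BI//|uB] := ltnP B (mdeg u).
apply: NNPP => uI.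
suff : (mdeg u < d)%N by rewrite ltnNge du.
apply: (socle_degree Fres degF Wp uW uI) => k kW.
apply: IHr; rewrite ?mdegD ?mdeg1; try lia.
move=> j; rewrite mnmDE mnm1E; case: eqP => [<- //|_]; rewrite addn0; exact: uW.
Qed.

End Socle.

(** * Powers of the ideal *)

Lemma mem_ideal_exp_mon (K : fieldType) n (I : {mpoly K[n]} -> Prop) d s :
  (forall a : 'X_{1..n}, mdeg a = d -> (#|[set i | 0 < a i]| <= s.+1)%N ->
     I 'X_[a]) ->
  forall t (m : 'X_{1..n}), mdeg m = (t * d)%N ->
    (#|[set i | 0 < m i]| <= t * s + 1)%N -> ideal_exp I t 'X_[m].
Proof.
move=> Ia; elim=> [//|t IHt] m md mcard.
have [c [cm cd ccard rcard]] := split_block mcard (etrans (esym (mdegE m)) md).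
pose a : 'X_{1..n} := [multinom c i | i < n].
have am : (a <= m)%MM by apply/mnm_lepP => i; rewrite mnmE.
have aE : mdeg a = d by rewrite mdegE -cd; apply: eq_bigr => i _; rewrite mnmE.
rewrite -(submK am) addmC mpolyXD; apply: ideal_expSM.
  by apply: Ia => //; under eq_finset do rewrite mnmE.
apply: IHt.
  by apply: (@addnI d); rewrite -{1}aE -mdegD addmC submK // md mulSn.
by under eq_finset do rewrite mnmBE mnmE subn_gt0.
Qed.

Theorem theorem8p1 (K : fieldType) (n : nat) (n_gt0 : (0 < n)%N)
    (I : {mpoly K[n]} -> Prop) (d : nat)
    (I_mon : monomial_ideal I)
    (I_primary : primary_to I (max_ideal K n))
    (I_deg : generated_in_degree I d)
    (I_pres : linearly_presented I d)
    (s : nat) (s_ge1 : (1 <= s)%N)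
    (I_lin : linear_for_steps I d s)
    (t : nat) (t_ge : (n%:R - 1) / s%:R <= t%:R :> rat) :
  ideal_eq (ideal_exp I t) (ideal_exp (max_ideal K n) (t * d)).
Proof.
have nts : (n <= t * s + 1)%N.
  move: t_ge; rewrite ler_pdivrMr ?ltr0n // lerBlDr -natrM natr1 ler_nat.
  by rewrite addn1.
have [_ radI] := I_primary; have [F Fres degF] := I_lin.
have I_max f : I f -> max_ideal K n f by move=> If; apply/radI; exists 1%N.
have I_pow (k : 'I_n) : exists e, I ('X_k ^+ e).
  by apply/radI/mem_ideal_gen; exists k.
have I_small (a : 'X_{1..n}) : mdeg a = d ->
    (#|[set i | (0 < a i)%N]| <= s.+1)%N -> I 'X_[a].
  move=> ad acard.
  (* When d = 0 the support is empty; any single variable then serves as W. *)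
  pose i0 : 'I_n := Ordinal n_gt0.
  have [W [aW W_gt0 Ws]] : exists W : {set 'I_n},
      [/\ forall k, (0 < a k)%N -> k \in W, (0 < #|W|)%N & (#|W| <= s.+1)%N].
    have [a0|] := posnP #|[set i | (0 < a i)%N]|.
      exists [set i0]; rewrite cards1; split=> // k ak.
      by move/cards0_eq/setP: a0 => /(_ k); rewrite !inE ak.
    by exists [set i | (0 < a i)%N]; split=> // k; rewrite inE.
  apply: (small_support_mem I_mon I_max I_pow (p := #|W|.-1) (W := W) Fres)
    aW _.
  - by move=> j; apply: degF; lia.
  - by rewrite prednK.
  - by rewrite ad.
have I_ord f : I f -> order_ge d f.
  move=> /I_deg; apply: order_ge_gen => g [_ /dhomog_mf gd] m /gd -> //.
have max_ord f : ideal_exp (max_ideal K n) (t * d) f -> order_ge (t * d) f.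
  by move=> /(order_ge_exp (@order_ge_max K n)); rewrite muln1.
move=> f; split=> [/(order_ge_exp I_ord)|/max_ord] ford;
  apply: is_ideal_msupp (@ideal_exp_is_ideal _ _ _) _ => m /ford tdm.
  exact: mem_max_exp.
have [a ad am] := submonomial_split tdm.
apply: (is_ideal_Xle (@ideal_exp_is_ideal _ _ _) am).
apply: (mem_ideal_exp_mon I_small) => //.
by apply: leq_trans nts; rewrite -[n in (_ <= n)%N]card_ord max_card.
Qed.
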